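(* Let $\mathfrak g=\mathfrak g(\gamma,Q)$ with $\gamma$ generic and $Q$ rational in the normal form described in the context. Then the universal central extension $\tilde{\mathfrak g}$ of $\mathfrak g$ has a center of dimension $2$, with a basis $c_1,c_2$. More specifically, $\tilde{\mathfrak g}=\mathfrak g\oplus\mathbb C c_1\oplus\mathbb C c_2$ as a vector space, with Lie bracket $$\begin{aligned} &[L_{\mathbf m},L_{\mathbf n}]'=(\gamma\mid\mathbf n-\mathbf m)L_{\mathbf m+\mathbf n}+\delta_{\mathbf m+\mathbf n,\mathbf 0}\,\frac{[\mathbf m]_\gamma^3-[\mathbf m]_\gamma}{12}\,c_1,\\ &[L_{\mathbf m},L_{\mathbf s}]'=(\gamma\mid\mathbf s)L_{\mathbf m+\mathbf s},\\ &[L_{\mathbf r},L_{\mathbf s}]'=(\sigma(\mathbf r,\mathbf s)-\sigma(\mathbf s,\mathbf r))L_{\mathbf r+\mathbf s}+\delta_{\mathbf r+\mathbf s,\mathbf 0}\,\sigma(\mathbf r,-\mathbf r)\,[\mathbf r]_\gamma\,c_2,\\ &[c_1,\tilde{\mathfrak g}]'=[c_2,\tilde{\mathfrak g}]'=0, \end{aligned}$$ for $\mathbf m,\mathbf n\in R$ and $\mathbf r,\mathbf s\in\mathbb Z^d\setminus R$, where $[\mathbf m]_\gamma=\frac{(\gamma\mid\mathbf m)}{(\gamma\mid k_1\epsilon_1)}$ and $[\mathbf r]_\gamma=\frac{(\gamma\mid\mathbf r)}{(\gamma\mid k_1\epsilon_1)}$. Here, writing $\alpha(x,y)=[x,y]'-[x,y]\in\mathbb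 C c_1\oplus\mathbb C c_2$ for $x,y\in\mathfrak g$, one has $c_1=2\alpha(L_{2k_1\epsilon_1},L_{-2k_1\epsilon_1})$ and $c_2=k_1\alpha(L_{\epsilon_1},L_{-\epsilon_1})$.
   Context: Let $d>1$ be an integer, let $\epsilon_1,\dots,\epsilon_d$ be the standard $\mathbb Z$-basis of $\mathbb Z^d$, and let $\gamma=(\gamma_1,\dots,\gamma_d)\in\mathbb C^d$ be generic, i.e. $\gamma_1,\dots,\gamma_d$ are linearly independent over $\mathbb Q$. Put $(\gamma\mid\mathbf n)=\sum_{i=1}^d\gamma_in_i$. Let $Q=(q_{ij})$ be a $d\times d$ complex matrix in the following normal form: there is a positive integer $z$ with $2z\le d$ such that all entries of $Q$ equal $1$ except $q_{2i-1,2i}=q_{2i-1}$ and $q_{2i,2i-1}=q_{2i}=q_{2i-1}^{-1}$ for $1\le i\le z$, where each $q_i$ ($1\le i\le 2z$) is a root of unity of order $k_i>1$, with $k_{2j-1}=k_{2j}$ for $1\le j\le z$ and $k_{i+1}\mid k_i$ for $1\le i\le 2z-1$; put $k_l=1$ for $l>2z$. For $\mathbf m,\mathbf n\in\mathbb Z^d$ put $\sigma(\mathbf m,\mathbf n)=\prod_{1\le i<j\le d}q_{ji}^{m_jn_i}$ and $R=\{\mathbf m\in\mathbb Z^d\mid\sigma(\mathbf m,\mathbf n)=\sigma(\mathbf n,\mathbf m)\text{ for all }\mathbf n\in\mathbb Z^d\}$; then $R=\bigoplus_{i=1}^dk_i\mathbb Z\epsilon_i$ and $\sigma(\mathbf m,\mathbf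 n)=1$ for $\mathbf m\in R$, $\mathbf n\in\mathbb Z^d$. The complex Lie algebra $\mathfrak g=\mathfrak g(\gamma,Q)$ has basis $\{L_{\mathbf m}\mid\mathbf m\in\mathbb Z^d\}$ and brackets $$[L_{\mathbf m},L_{\mathbf n}]=(\gamma\mid\mathbf n-\mathbf m)L_{\mathbf m+\mathbf n},\quad [L_{\mathbf m},L_{\mathbf s}]=(\gamma\mid\mathbf s)L_{\mathbf m+\mathbf s},\quad [L_{\mathbf r},L_{\mathbf s}]=(\sigma(\mathbf r,\mathbf s)-\sigma(\mathbf s,\mathbf r))L_{\mathbf r+\mathbf s}$$ for $\mathbf m,\mathbf n\in R$ and $\mathbf r,\mathbf s\in\mathbb Z^d\setminus R$. It satisfies $[\mathfrak g,\mathfrak g]=\mathfrak g$, so it has a universal central extension. *)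

(* Defs.v *)
From HB Require Import structures.
From mathcomp Require Import all_boot all_order all_algebra.
From mathcomp Require Import boolp reals.
From mathcomp Require Export complex.
From mathcomp Require Export finmap monalg.

Set Implicit Arguments.
Unset Strict Implicit.
Unset Printing Implicit Defensive.

Import GRing.Theory Num.Theory.
Local Open Scope ring_scope.

Record lie_bracket (K : fieldType) (V : lmodType K) (br : V -> V -> V) : Prop :=
  LieBracket {
    lie_linearl : forall y, linear (br^~ y);
    lie_linearr : forall x, linear (br x);
    lie_alt : forall x, br x x = 0;
    lie_jacobi : forall x y w,
      br x (br y w) + br y (br w x) + br w (br x y) = 0
  }.

Definition lie_hom (K : fieldType) (V W : lmodType K)
    (brV : V -> V -> V) (brW : W -> W -> W) (f : V -> W) : Prop :=
  linear f /\ forall x y, f (brV x y) = brW (f x) (f y).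

Definition lie_center (K : fieldType) (V : lmodType K) (br : V -> V -> V)
  (x : V) : Prop := forall y, br x y = 0.

Record central_extension (K : fieldType) (V E : lmodType K)
    (brV : V -> V -> V) (brE : E -> E -> E) (p : E -> V) : Prop :=
  CentralExtension {
    cext_base : lie_bracket brV;
    cext_total : lie_bracket brE;
    cext_hom : lie_hom brE brV p;
    cext_surj : forall v, exists e, p e = v;
    cext_central : forall e, p e = 0 -> lie_center brE e
  }.

Definition universal_central_extension (K : fieldType) (V E : lmodType K)
    (brV : V -> V -> V) (brE : E -> E -> E) (p : E -> V) : Prop :=
  central_extension brV brE p /\
  forall (F : lmodType K) (brF : F -> F -> F) (q : F -> V),
    central_extension brV brF q ->
    exists! f : E -> F, lie_hom brE brF f /\ forall e, q (f e) = p e.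

(* Coordinates are 0-based: the basis vector epsilon_i, 1 <= i <= d, is eps j
   with (j : nat) = i - 1. *)
Notation lattice d := 'rV[int]_d.

Definition eps (d : nat) (i : 'I_d) : lattice d := delta_mx 0 i.

Definition pairing (C : numFieldType) (d : nat) (gam : 'rV[C]_d)
  (n : lattice d) : C := \sum_(i < d) gam 0 i * (n 0 i)%:~R.

Definition generic (C : numFieldType) (d : nat) (gam : 'rV[C]_d) : Prop :=
  forall a : 'rV[rat]_d, \sum_(i < d) ratr (a 0 i) * gam 0 i = 0 -> a = 0.

(* Up to the shift of indices, (a, b) = (2i - 1, 2i) with 1 <= i <= z. *)
Definition coupled (d z : nat) (a b : 'I_d) : bool :=
  [&& ~~ odd a, b == a.+1 :> nat & (b < 2 * z)%N].

(* Only the values q i with i < 2 * z are meaningful. *)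
Record normal_form (C : numFieldType) (d : nat) (Q : 'M[C]_d) (z : nat)
    (q : 'I_d -> C) (k : 'I_d -> nat) : Prop := NormalForm {
  nf_z_gt0 : (0 < z)%N;
  nf_z_le : (2 * z <= d)%N;
  nf_entry : forall a b : 'I_d,
    Q a b = if coupled z a b || coupled z b a then q a else 1;
  nf_inv : forall a b : 'I_d, coupled z a b -> q b = (q a)^-1;
  nf_order : forall a : 'I_d, (a < 2 * z)%N ->
    (1 < k a)%N /\ (k a).-primitive_root (q a);
  nf_k_eq : forall a b : 'I_d, coupled z a b -> k a = k b;
  nf_k_dvd : forall a b : 'I_d,
    b = a.+1 :> nat -> (b < 2 * z)%N -> (k b %| k a)%N;
  nf_k_out : forall a : 'I_d, (2 * z <= a)%N -> k a = 1%N
}.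

Definition sigma (C : numFieldType) (d : nat) (Q : 'M[C]_d)
  (m n : lattice d) : C :=
  \prod_(i < d) \prod_(j < d | (i < j)%N) Q j i ^ (m 0 j * n 0 i).

Definition sradical (C : numFieldType) (d : nat) (Q : 'M[C]_d)
  (m : lattice d) : Prop := forall n, sigma Q m n = sigma Q n m.

(* Coefficient of L_(m+n) in [L_m, L_n]; the case m outside the radical and n
   inside it is forced by skew-symmetry. *)
Definition str_const (C : numFieldType) (d : nat) (gam : 'rV[C]_d)
  (Q : 'M[C]_d) (m n : lattice d) : C :=
  match `[< sradical Q m >], `[< sradical Q n >] with
  | true, true => pairing gam (n - m)
  | true, false => pairing gam n
  | false, true => - pairing gam m
  | false, false => sigma Q m n - sigma Q n m
  end.

(* The underlying space of g(gamma, Q) is that of finitely supported functions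
   Z^d -> C; only its module structure is used. *)
Notation gspace C d := {malg C[lattice d]}.

Definition Lb (C : numFieldType) (d : nat) (m : lattice d) : gspace C d :=
  << m >>.

Definition gbr (C : numFieldType) (d : nat) (gam : 'rV[C]_d) (Q : 'M[C]_d)
  (x y : gspace C d) : gspace C d :=
  \sum_(m <- msupp x) \sum_(n <- msupp y)
    (x@_m * y@_n * str_const gam Q m n) *: Lb C (m + n).

(* The regular module C^o makes the product a C-vector space. *)
Notation gtspace C d := (gspace C d * C^o * C^o)%type.

Definition gincl (C : numFieldType) (d : nat) (x : gspace C d) : gtspace C d :=
  (x, 0, 0).

Definition gproj (C : numFieldType) (d : nat) (x : gtspace C d) : gspace C d :=
  x.1.1.

Definition c1 (C : numFieldType) (d : nat) : gtspace C d := (0, 1, 0).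

Definition c2 (C : numFieldType) (d : nat) : gtspace C d := (0, 0, 1).

(* Main.v *)
From HB Require Import structures.
Require Import Defs.
From mathcomp Require Import all_boot all_order all_algebra.
From mathcomp Require Import boolp reals.
From mathcomp Require Import ring.

Set Implicit Arguments.
Unset Strict Implicit.
Unset Printing Implicit Defensive.

Import GRing.Theory Num.Theory.
Local Open Scope ring_scope.

(** The algebra is spanned by the L_m, graded by the lattice, and L_0 acts
    on L_m by the scalar (gamma | m); since gamma is generic, distinct
    degrees have distinct eigenvalues. This rigidity controls every central
    extension F of the algebra. Lift L_0 arbitrarily and lift L_m, for m
    nonzero, to its unique eigenvector X_m for that scalar ([weight_lift]).
    Then [X_m, X_n] is exactly the right multiple of X_(m+n) as soon as
    m + n <> 0, so all that remains of the cocycle is the central defect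
    b(m) = [X_m, X_(-m)] - (structure constant) X_0, a function of one
    variable. The Jacobi identity says that b is odd and satisfies one
    relation for each triple of sum zero; such functions are called diagonal
    cocycles here.

    Diagonal cocycles are then classified ([diag_cocycle_classification]).
    Fix a nonzero e in the radical; choosing X_0 well makes b(e) = 0.

    On the radical the relation is that of the Witt algebra, (x - y) b(m+n)
    = (x + 2y) b(m) - (2x + y) b(n) with x = (gamma | m) and y = (gamma |
    n). If b also vanishes at 2e, then computing b(m + 2e) from b(m) in one
    step of length 2e or in two steps of length e gives two answers which,
    once denominators are cleared, differ by 12 y^3 b(m), where
    y = (gamma | e); hence b = 0 on the whole radical ([diag_rad_eq0]), and
    b(2e) is the only parameter, carried by the Virasoro cocycle.

    Off the radical, write b(r) = sigma(r, -r) (gamma | r) c(r). The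
    relation for one radical and two non-radical degrees says that c is
    invariant under translation by the radical. Comparing the relation for
    (r, s, t) with the one for (r + e, s - e, t) leaves c(r) = c(s) whenever
    L_r and L_s do not commute ([ratio_eq_comm]). Any two non-radical
    degrees have a common non-commuting partner, because a group is not the
    union of two proper subgroups ([comm_connected]); so c is constant, and
    it is the second parameter.

    Conversely both cocycles occur, so they define an extension of the
    algebra by a plane, and the two parameters of F define the map from it
    to F. The map is unique because the extension is spanned by brackets
    ([ebracket_span]). *)

(** * Linear and bilinear extension from monomials *)

Section LinearPredicate.
Variables (K : fieldType) (U V : lmodType K) (f : U -> V).
Hypothesis f_lin : linear f.

Let F : {linear U -> V} := HB.pack f (GRing.isLinear.Build K U V *:%R f f_lin).

Lemma lin0 : f 0 = 0. Proof. exact: (linear0 F). Qed.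
Lemma linD : {morph f : u v / u + v}. Proof. exact: (linearD F). Qed.
Lemma linB : {morph f : u v / u - v}. Proof. exact: (linearB F). Qed.
Lemma linZ a : {morph f : u / a *: u}. Proof. exact: (linearZ_LR F). Qed.

End LinearPredicate.

Section LinearExtension.
Variables (K : fieldType) (I : choiceType) (V : lmodType K).
Implicit Types (x y : {malg K[I]}) (X : I -> V) (B : I -> I -> V).

Definition mlift X x : V := \sum_(m <- msupp x) x@_m *: X m.

Definition bilift B x y : V := mlift (fun m => mlift (B m) y) x.

Lemma mliftEw X x (D : {fset I}) :
  (msupp x `<=` D)%fset -> mlift X x = \sum_(m <- D) x@_m *: X m.
Proof.
move=> sxD; rewrite /mlift (big_fset_incl _ sxD) // => m _ mx.
by rewrite mcoeff_outdom // scale0r.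
Qed.

Lemma mlift_linear X : linear (mlift X).
Proof.
move=> a x y; set D := (msupp x `|` msupp y)%fset.
have sxD : (msupp x `<=` D)%fset by apply: fsubsetUl.
have syD : (msupp y `<=` D)%fset by apply: fsubsetUr.
have sD : (msupp (a *: x + y) `<=` D)%fset.
  apply: fsubset_trans (msuppD_le _ _) _; apply: fsetUSS => //.
  exact: msuppZ_le.
rewrite (mliftEw X sxD) (mliftEw X syD) (mliftEw X sD) scaler_sumr -big_split.
by apply: eq_bigr => m _ /=; rewrite mcoeffD mcoeffZ scalerDl scalerA.
Qed.

Lemma mliftU X m : mlift X << m >> = X m.
Proof.
by rewrite (mliftEw X msuppU_le) big_seq_fset1 mcoeffUU scale1r.
Qed.

Lemma malg_linearE (f : {malg K[I]} -> V) :
  linear f -> forall x, f x = mlift (fun m => f << m >>) x.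
Proof.
move=> f_lin x; rewrite {1}[x]monalgE.
rewrite (big_morph f (linD f_lin) (lin0 f_lin)).
apply: eq_bigr => m _; rewrite -(linZ f_lin); congr (f _).
by apply/malgP => n; rewrite mcoeffZ !mcoeffU mulrnAr mulr1.
Qed.

Lemma malg_linear_ext (f g : {malg K[I]} -> V) :
  linear f -> linear g -> (forall m, f << m >> = g << m >>) -> f =1 g.
Proof.
move=> f_lin g_lin fg x; rewrite (malg_linearE f_lin) (malg_linearE g_lin).
by apply: eq_bigr => m _; rewrite fg.
Qed.

Lemma bilift_linearl B y : linear (bilift B ^~ y).
Proof. exact: mlift_linear. Qed.

Lemma bilift_linearr B x : linear (bilift B x).
Proof.
move=> a y z; rewrite /bilift [in RHS]/mlift scaler_sumr -big_split.
apply: eq_bigr => m _ /=; rewrite mlift_linear scalerDr.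
by rewrite scalerA mulrC -scalerA.
Qed.

Lemma biliftU B m n : bilift B << m >> << n >> = B m n.
Proof. by rewrite /bilift !mliftU. Qed.

Lemma malg_bilinear_ext (f g : {malg K[I]} -> {malg K[I]} -> V) :
    (forall y, linear (f^~ y)) -> (forall x, linear (f x)) ->
    (forall y, linear (g^~ y)) -> (forall x, linear (g x)) ->
    (forall m n, f << m >> << n >> = g << m >> << n >>) ->
  forall x y, f x y = g x y.
Proof.
move=> fl fr gl gr fg x y.
apply: (malg_linear_ext (fl y) (gl y)) => m.
exact: (malg_linear_ext (fr << m >>) (gr << m >>)).
Qed.

End LinearExtension.

(** * Lie brackets defined on a basis *)

Section LieFromBasis.
Variables (K : fieldType) (I : choiceType) (E : lmodType K).
Variables (pr : E -> {malg K[I]}) (B : I -> I -> E).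
Hypotheses (two_neq0 : 2%:R != 0 :> K) (pr_lin : linear pr).
Hypothesis B_skew : forall m n, B m n = - B n m.
Hypothesis B_jacobi : forall m n l,
  bilift B << m >> (pr (B n l)) + bilift B << n >> (pr (B l m))
    + bilift B << l >> (pr (B m n)) = 0.

Let T x y z := bilift B x (pr (bilift B y z)).

Let J x y z := T x y z + T y z x + T z x y.

Let JC x y z : J x y z = J y z x.
Proof. by rewrite /J -addrA addrC. Qed.

Let J_linear y z : linear (fun x => J x y z).
Proof.
move=> a x x'; rewrite /J /T.
rewrite (bilift_linearl B (pr (bilift B y z)) a x x').
rewrite (bilift_linearr B z a x x') pr_lin bilift_linearr.
rewrite (bilift_linearl B y a x x') pr_lin bilift_linearr.
by rewrite !scalerDr [RHS]addrACA; congr (_ + _); rewrite addrACA.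
Qed.

Let J_eq0 x y z : J x y z = 0.
Proof.
have zero_lin : linear (fun=> 0 : E) by move=> a u v; rewrite scaler0 addr0.
have from_basis y' z' : (forall m, J << m >> y' z' = 0) ->
  forall x', J x' y' z' = 0.
  exact: (malg_linear_ext (J_linear y' z') (zero_lin {malg K[I]})).
apply: (from_basis) => m; rewrite JC; apply: (from_basis) => n; rewrite JC.
by apply: (from_basis) => l; rewrite /J /T !biliftU.
Qed.

Lemma lie_bracket_bilift : lie_bracket (fun u v => bilift B (pr u) (pr v)).
Proof.
split=> [v a u u' | u a v v' | u | u v w]; last exact: J_eq0.
- by rewrite pr_lin bilift_linearl.
- by rewrite pr_lin bilift_linearr.
have skew x y : bilift B x y = - bilift B y x.
  apply: (@malg_bilinear_ext _ _ _ (bilift B) (fun x y => - bilift B y x))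
    => [y'|x'|y'|x'|m n].
  - exact: bilift_linearl.
  - exact: bilift_linearr.
  - by move=> a s t; rewrite bilift_linearr opprD scalerN.
  - by move=> a s t; rewrite bilift_linearl opprD scalerN.
  - by rewrite !biliftU B_skew.
have /eqP := skew (pr u) (pr u).
by rewrite -addr_eq0 -mulr2n -scaler_nat scaler_eq0 (negPf two_neq0) => /eqP.
Qed.

End LieFromBasis.

(** * The Lie algebra attached to a pairing and a bicharacter *)

Section Structure.
Variables (K : numFieldType) (M : zmodType).
Variables (p : M -> K) (sg : M -> M -> K).

Definition rad (m : M) : bool := `[< forall n, sg m n = sg n m >].

(** The commutator coefficient of the quantum torus with cocycle sg. *)
Definition comm m n := sg m n - sg n m.

Definition strc m n : K :=
  match rad m, rad n with
  | true, true => p (n - m)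
  | true, false => p n
  | false, true => - p m
  | false, false => comm m n
  end.

(** What the normal form of Q and the genericity of gamma contribute to the
    proof: sg is a bicharacter, trivial on its radical, and p separates the
    points of the grading group. *)
Record torus_datum : Prop := TorusDatum {
  pairB : {morph p : m n / m - n};
  pair_eq0 : forall m, p m = 0 -> m = 0;
  sgDl : forall m n l, sg (m + n) l = sg m l * sg n l;
  sgDr : forall m n l, sg l (m + n) = sg l m * sg l n;
  sg_neq0 : forall m n, sg m n != 0;
  sg_rad : forall m n, rad m -> sg m n = 1
}.

Hypothesis D : torus_datum.

Lemma pair0 : p 0 = 0.
Proof. by have := pairB D 0 0; rewrite !subrr. Qed.

Lemma pairN : {morph p : m / - m}.
Proof. by move=> m; rewrite -sub0r (pairB D) pair0 sub0r. Qed.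

Lemma pairD : {morph p : m n / m + n}.
Proof. by move=> m n; rewrite -[n]opprK (pairB D) pairN !opprK. Qed.

Lemma pair_neq0 m : m != 0 -> p m != 0.
Proof. by apply: contra_neq; exact: pair_eq0. Qed.

Lemma sg0l n : sg 0 n = 1.
Proof.
apply: (mulfI (sg_neq0 D 0 n)).
by rewrite -(sgDl D) addr0 mulr1.
Qed.

Lemma sg0r n : sg n 0 = 1.
Proof.
apply: (mulfI (sg_neq0 D n 0)).
by rewrite -(sgDr D) addr0 mulr1.
Qed.

Lemma sgNl m n : sg (- m) n = (sg m n)^-1.
Proof.
apply: (mulfI (sg_neq0 D m n)).
by rewrite -(sgDl D) subrr sg0l divff ?(sg_neq0 D).
Qed.

Lemma sgNr m n : sg n (- m) = (sg n m)^-1.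
Proof.
apply: (mulfI (sg_neq0 D n m)).
by rewrite -(sgDr D) subrr sg0r divff ?(sg_neq0 D).
Qed.

Lemma sg_radr m n : rad m -> sg n m = 1.
Proof. by move=> Rm; rewrite -(asboolP _ Rm) (sg_rad D). Qed.

Lemma rad0 : rad 0.
Proof. by apply/asboolP => n; rewrite sg0l sg0r. Qed.

Lemma radN m : rad (- m) = rad m.
Proof.
suff imp n : rad n -> rad (- n).
  by apply/idP/idP => [/imp|/imp //]; rewrite opprK.
by move=> /asboolP Rn; apply/asboolP => l; rewrite sgNl sgNr Rn.
Qed.

Lemma radD m n : rad m -> rad (m + n) = rad n.
Proof.
have closed a b : rad a -> rad b -> rad (a + b).
  move=> /asboolP Ra /asboolP Rb; apply/asboolP => l.
  by rewrite (sgDl D) (sgDr D) Ra Rb.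
move=> Rm; apply/idP/idP => [Rmn|]; last exact: closed.
by rewrite -[n](addKr m); apply: closed => //; rewrite radN.
Qed.

Lemma radDr m n : rad n -> rad (m + n) = rad m.
Proof. by move=> Rn; rewrite addrC radD. Qed.

Lemma non_rad_neq0 r : ~~ rad r -> r != 0.
Proof. by apply: contraNneq => ->; exact: rad0. Qed.

Lemma commC m n : comm m n = - comm n m.
Proof. by rewrite /comm opprB. Qed.

Lemma comm_addl_rad a m n : rad a -> comm (a + m) n = comm m n.
Proof.
move=> Ra; rewrite /comm (sgDl D) (sgDr D).
by rewrite (sg_rad D _ Ra) (sg_radr _ Ra) !mul1r.
Qed.

Lemma comm_addr_rad a m n : rad a -> comm m (a + n) = comm m n.
Proof. by move=> Ra; rewrite commC comm_addl_rad // -commC. Qed.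

Lemma comm_radl m n : rad m -> comm m n = 0.
Proof. by move=> Rm; rewrite /comm (sg_rad D _ Rm) (sg_radr _ Rm) subrr. Qed.

Lemma comm_radr m n : rad n -> comm m n = 0.
Proof. by move=> Rn; rewrite commC comm_radl // oppr0. Qed.

(** Pairing m + n with n gives 1 on either side; cancel the common factor
    sg(n, n). *)
Lemma comm_rad_add m n : rad (m + n) -> comm m n = 0.
Proof.
move=> Rmn; apply/eqP; rewrite subr_eq0; apply/eqP.
apply: (mulIf (sg_neq0 D n n)).
by rewrite -(sgDl D) -(sgDr D) (sg_rad D _ Rmn) (sg_radr _ Rmn).
Qed.

Lemma strc_skew m n : strc m n = - strc n m.
Proof.
rewrite /strc; case: (rad m); case: (rad n); rewrite ?opprK //.
- by rewrite !(pairB D) opprB.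
- exact: commC.
Qed.

Lemma strc0 m : strc 0 m = p m.
Proof. by rewrite /strc rad0 subr0; case: (rad m). Qed.

Lemma strc_opp m : strc m (- m) = if rad m then - (2%:R * p m) else 0.
Proof.
rewrite /strc radN; case: (rad m).
  by rewrite (pairB D) pairN; ring.
by rewrite comm_rad_add // subrr rad0.
Qed.

(** The degree n + l may fall in the radical, where the structure constants
    are of another kind; but then L_n and L_l commute, so one formula serves
    both cases. *)
Lemma strc_mul_non_rad m n l : ~~ rad n -> ~~ rad l ->
  strc n l * strc m (n + l)
    = comm n l * (if rad m then p (n + l) else comm m (n + l)).
Proof.
move=> /negPf Rn /negPf Rl; rewrite /strc Rn Rl.
case Rnl: (rad (n + l)); first by rewrite comm_rad_add ?Rnl // !mul0r.
by case: (rad m).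
Qed.

Definition jacobiator m n l :=
  strc n l * strc m (n + l) + strc l m * strc n (l + m)
    + strc m n * strc l (m + n).

Lemma jacobiatorC m n l : jacobiator m n l = jacobiator n l m.
Proof. by rewrite /jacobiator -addrA addrC. Qed.

(** Up to cyclic permutation only the number of radical degrees matters.
    These act as derivations proportional to the degree, and on the others
    the bracket is the commutator of an associative algebra. *)
Lemma strc_jacobi m n l : jacobiator m n l = 0.
Proof.
have RRR a b c : rad a -> rad b -> rad c -> jacobiator a b c = 0.
  move=> Ra Rb Rc; rewrite /jacobiator /strc !(radD _ Ra, radD _ Rb, radD _ Rc).
  by rewrite Ra Rb Rc !(pairB D) !pairD; ring.
have RRN a b c : rad a -> rad b -> ~~ rad c -> jacobiator a b c = 0.
  move=> Ra Rb /negPf Rc.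
  rewrite /jacobiator /strc (radD _ Ra) (radD _ Rb) (radDr _ Ra) Ra Rb Rc.
  by rewrite !(pairB D) !pairD; ring.
have RNN a b c : rad a -> ~~ rad b -> ~~ rad c -> jacobiator a b c = 0.
  move=> Ra Rb Rc; rewrite /jacobiator strc_mul_non_rad // Ra pairD.
  rewrite /strc (radD _ Ra) (radDr _ Ra) Ra (negPf Rb) (negPf Rc).
  by rewrite addrC [c + a]addrC !comm_addr_rad // (commC c b); ring.
have NNN a b c : ~~ rad a -> ~~ rad b -> ~~ rad c -> jacobiator a b c = 0.
  move=> Ra Rb Rc; rewrite /jacobiator !strc_mul_non_rad //.
  rewrite (negPf Ra) (negPf Rb) (negPf Rc) /comm !(sgDl D) !(sgDr D).
  by ring.
have [Rm|Rm] := boolP (rad m); have [Rn|Rn] := boolP (rad n);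
  have [Rl|Rl] := boolP (rad l);
  by [auto | rewrite jacobiatorC; auto | rewrite -jacobiatorC; auto].
Qed.

(** * Diagonal cocycles *)

(** A 2-cocycle supported on pairs of opposite degrees is a function of one
    degree; [diag_rel] is the cocycle identity on a triple of sum zero. *)
Record diag_cocycle (V : lmodType K) (b : M -> V) : Prop := DiagCocycle {
  diag_odd : forall m, b (- m) = - b m;
  diag_rel : forall m n l, m + n + l = 0 ->
    strc n l *: b m + strc l m *: b n + strc m n *: b l = 0
}.

Lemma diag_cocycleB (V : lmodType K) (b : M -> V) (c : M -> K^o) (a : V) :
  diag_cocycle b -> diag_cocycle c -> diag_cocycle (fun m => b m - c m *: a).
Proof.
move=> [b_odd b_rel] [c_odd c_rel]; split=> [m | m n l mnl0].
  by rewrite b_odd c_odd scaleNr opprK opprB addrC.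
rewrite !scalerBr !scalerA [X in X + _ = _]addrACA -opprD.
rewrite addrACA -opprD b_rel //.
by rewrite -!scalerDl c_rel // scale0r subr0.
Qed.

Lemma opp_of_sum0 (m n l : M) : m + n + l = 0 -> l = - (m + n).
Proof. by move=> mnl0; apply/esym/addr0_eq. Qed.

(** The relation is invariant under cyclic permutation, and a triple of sum
    zero cannot have exactly two terms in the radical. *)
Lemma diag_rel_wlog (V : lmodType K) (b : M -> V) :
    let rel m n l :=
      strc n l *: b m + strc l m *: b n + strc m n *: b l = 0 in
    (forall m n l, m + n + l = 0 -> rad m -> rad n -> rad l -> rel m n l) ->
    (forall m n l, m + n + l = 0 -> rad m -> ~~ rad n -> ~~ rad l ->
       rel m n l) ->
    (forall m n l, m + n + l = 0 -> ~~ rad m -> ~~ rad n -> ~~ rad l ->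
       rel m n l) ->
  forall m n l, m + n + l = 0 -> rel m n l.
Proof.
move=> rel RRR RNN NNN m n l mnl0.
have relC a b' c : rel a b' c -> rel b' c a.
  by rewrite /rel -addrA [X in X = _ -> _]addrC.
have nlm0 : n + l + m = 0 by rewrite addrC addrA.
have lmn0 : l + m + n = 0 by rewrite -addrA addrC.
have third a b' c : a + b' + c = 0 -> rad a -> rad b' -> rad c.
  by move=> abc0 Ra Rb; rewrite (opp_of_sum0 abc0) radN radD.
have [Rm|Rm] := boolP (rad m); have [Rn|Rn] := boolP (rad n);
  have [Rl|Rl] := boolP (rad l);
  try by [auto | apply: relC; auto | apply: relC; apply: relC; auto].
- by rewrite (third m n l) in Rl.
- by rewrite (third l m n) in Rn.
- by rewrite (third n l m) in Rm.
Qed.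

Section ReferencePoint.
Variable e : M.
Hypotheses (rad_e : rad e) (e_neq0 : e != 0).

Let pe_neq0 : p e != 0. Proof. exact: pair_neq0. Qed.

(** The value at (L_m, L_(-m)) of the Virasoro cocycle, with [p e] as the
    unit of degree. *)
Definition virasoro_diag m : K^o :=
  if rad m then ((p m / p e) ^+ 3 - p m / p e) / 12%:R else 0.

(** The value at (L_r, L_(-r)) of (x, y) |-> tau(D(x) y), where D is the
    degree derivation and tau the trace of the quantum torus, i.e. the
    coefficient in degree 0. *)
Definition trace_diag m : K^o := if rad m then 0 else sg m (- m) * (p m / p e).

Lemma virasoro_diag_cocycle : diag_cocycle virasoro_diag.
Proof.
split=> [m|].
  by rewrite /virasoro_diag radN pairN; case: ifP => _; [field | rewrite oppr0].
apply: diag_rel_wlog => m n l mnl0.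
- move=> Rm Rn Rl; rewrite /virasoro_diag /strc Rm Rn Rl /= (opp_of_sum0 mnl0).
  by rewrite !(pairB D) pairN pairD /GRing.scale /=; field.
- move=> Rm Rn Rl; rewrite /virasoro_diag (negPf Rn) (negPf Rl) !scaler0 !addr0.
  rewrite /strc (negPf Rn) (negPf Rl) comm_rad_add ?scale0r //.
  by rewrite -radN -(opp_of_sum0 (l := m)) // addrC addrA.
- move=> Rm Rn Rl.
  by rewrite /virasoro_diag (negPf Rm) (negPf Rn) (negPf Rl) !scaler0 !addr0.
Qed.

(** With three non-radical degrees the relation is p(m) + p(n) + p(l) = 0
    times a factor which is common because the trace of a product of three
    monomials is invariant under cyclic permutation. *)
Lemma trace_diag_cocycle : diag_cocycle trace_diag.
Proof.
split=> [m|].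
  rewrite /trace_diag radN pairN; case: ifP => _; first by rewrite oppr0.
  by rewrite !(sgNl, sgNr, invrK) ; ring.
apply: diag_rel_wlog => m n l mnl0.
- by move=> Rm Rn Rl; rewrite /trace_diag Rm Rn Rl !scaler0 !addr0.
- move=> Rm Rn Rl; rewrite /trace_diag /strc Rm (negPf Rn) (negPf Rl).
  rewrite scaler0 add0r.
  rewrite (opp_of_sum0 mnl0) pairN pairD !opprK /GRing.scale /=.
  rewrite !(sgNl, sgNr) !(sgDl D) !(sgDr D) !(sg_rad D _ Rm) !(sg_radr _ Rm).
  have := sg_neq0 D n n => ?.
  by field; apply/andP.
- move=> Rm Rn Rl; rewrite /trace_diag /strc (negPf Rm) (negPf Rn) (negPf Rl).
  rewrite (opp_of_sum0 mnl0) pairN pairD !opprK /comm /GRing.scale /=.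
  rewrite !(sgNl, sgNr) !(sgDl D) !(sgDr D).
  by field; rewrite pe_neq0 !(sg_neq0 D).
Qed.

Section Classification.
Variables (V : lmodType K) (b : M -> V).
Hypothesis b_cocycle : diag_cocycle b.

(** The functional equation of the Virasoro cocycle. *)
Lemma diag_rel_rad m n : rad m -> rad n ->
  (p m - p n) *: b (m + n)
    = (p m + 2%:R * p n) *: b m - (2%:R * p m + p n) *: b n.
Proof.
move=> Rm Rn.
have := diag_rel b_cocycle (m := m) (n := n) (l := - (m + n)) (subrr _).
rewrite (diag_odd b_cocycle) /strc radN radD // Rm Rn !(pairB D) pairN pairD.
rewrite scalerN => /eqP; rewrite subr_eq0 -[p m - p n]opprB scaleNr => /eqP <-.
by rewrite opprD -!scaleNr; congr (_ *: _ + _ *: _); ring.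
Qed.

(** Moving from m to m + 2e by the functional equation, at once or through
    the point m + e, leads to two multiples of [b m] whose coefficients differ
    by 12 (p e)^3. *)
Lemma diag_rad_eq0 m : b e = 0 -> b (e + e) = 0 -> rad m -> b m = 0.
Proof.
move=> be0 bee0 Rm.
have Ree : rad (e + e) by rewrite radD.
have Rme : rad (m + e) by rewrite radD.
have E1 := diag_rel_rad Rm rad_e.
have E2 := diag_rel_rad Rme rad_e.
have E3 := diag_rel_rad Rm Ree.
rewrite be0 scaler0 subr0 in E1; rewrite -addrA be0 scaler0 subr0 in E2.
rewrite bee0 scaler0 subr0 pairD in E3; rewrite pairD in E2.
set x := p m in E1 E2 E3; set y := p e in E1 E2 E3.
(* F1 takes one step of length e + e, F2 two steps of length e; the left sides
   are multiplied so that the right sides agree. *)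
have F1 : (x * (x - y) * (x + 2%:R * (y + y))) *: b m
    = ((x - y) * (x - (y + y)) * x) *: b (m + (e + e)).
  by rewrite -scalerA -E3 scalerA; congr (_ *: _); ring.
have F2 : ((x - (y + y)) * (x + y + 2%:R * y) * (x + 2%:R * y)) *: b m
    = ((x - y) * (x - (y + y)) * x) *: b (m + (e + e)).
  rewrite -scalerA -E1 scalerA.
  rewrite (_ : _ * _ = (x - y) * (x - (y + y)) * (x + y + 2%:R * y));
    last by ring.
  by rewrite -scalerA -E2 scalerA; congr (_ *: _); ring.
have : (12%:R * y ^+ 3) *: b m = 0.
  transitivity ((x * (x - y) * (x + 2%:R * (y + y))) *: b m
    - ((x - (y + y)) * (x + y + 2%:R * y) * (x + 2%:R * y)) *: b m).
    by rewrite -scalerBl; congr (_ *: _); ring.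
  by rewrite F1 F2 subrr.
move/eqP; rewrite scaler_eq0 mulf_eq0 pnatr_eq0 expf_eq0 /= => /orP[|/eqP //].
by rewrite (negPf pe_neq0).
Qed.

(** The function c of the introduction: up to a constant factor, [b] divided
    by the trace cocycle. *)
Definition ratio r : V := (sg r (- r) * p r)^-1 *: b r.

Lemma sg_diag_rad m r : rad m -> sg (m + r) (- (m + r)) = sg r (- r).
Proof.
move=> Rm; have RmN : rad (- m) by rewrite radN.
by rewrite opprD !(sgDl D) !(sgDr D) !(sg_rad D _ Rm) (sg_radr _ RmN) !mul1r.
Qed.

Lemma pair_sg_neq0 r : r != 0 -> sg r (- r) * p r != 0.
Proof. by move=> r0; rewrite mulf_neq0 ?pair_neq0 ?(sg_neq0 D). Qed.

Lemma ratioK r : ~~ rad r -> b r = (sg r (- r) * p r) *: ratio r.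
Proof.
move=> Rr; rewrite scalerA divff ?scale1r //.
by apply: pair_sg_neq0; apply: non_rad_neq0.
Qed.

(** The relation for the degrees m, r and - (m + r) loses its term at m,
    because the other two have a radical sum and commute. *)
Lemma ratioD_rad m r : rad m -> ~~ rad r -> ratio (m + r) = ratio r.
Proof.
move=> Rm Rr; have Rmr : ~~ rad (m + r) by rewrite radD.
have := diag_rel b_cocycle (m := m) (n := r) (l := - (m + r)) (subrr _).
rewrite {1}/strc radN radD // (negPf Rr) comm_rad_add; last first.
  by rewrite opprD addrCA subrr addr0 radN.
rewrite scale0r add0r (diag_odd b_cocycle) /strc radN radD // Rm (negPf Rr).
rewrite pairN opprK scalerN => /eqP; rewrite subr_eq0 => /eqP rel.
rewrite /ratio; apply: (scalerI (pair_neq0 (non_rad_neq0 Rr))).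
apply: (scalerI (pair_neq0 (non_rad_neq0 Rmr))); rewrite !scalerA.
rewrite (sg_diag_rad _ Rm).
have sg_r := sg_neq0 D r (- r).
have [p_r p_mr] := (pair_neq0 (non_rad_neq0 Rr), pair_neq0 (non_rad_neq0 Rmr)).
transitivity ((sg r (- r))^-1 *: (p r *: b (m + r))).
  by rewrite scalerA; congr (_ *: _); field; apply/andP.
by rewrite -rel scalerA; congr (_ *: _); field; apply/andP.
Qed.

Lemma comm_neq0_non_rad r s :
  comm r s != 0 -> [/\ ~~ rad r, ~~ rad s & ~~ rad (r + s)].
Proof.
move=> comm_rs; split; apply: contraNN comm_rs => R_; apply/eqP.
- exact: comm_radl.
- exact: comm_radr.
- exact: comm_rad_add.
Qed.

(** Shifting r by e and s by - e changes neither the commutators nor the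
    ratios, only the factors p(r) and p(s); the difference of the two
    relations is p(e) times an identity between the two ratios alone. *)
Lemma ratio_eq_comm r s : comm r s != 0 -> ratio r = ratio s.
Proof.
move=> comm_rs; have [Rr Rs Rrs] := comm_neq0_non_rad comm_rs.
pose t := - (r + s).
have Rt : ~~ rad t by rewrite radN.
have Rer : ~~ rad (e + r) by rewrite radD.
have Res : ~~ rad (- e + s) by rewrite radD ?radN.
have commE : (sg s (- s) * comm r s = comm s t * (sg r s * sg s r)) /\
            (sg r (- r) * comm r s = comm t r * (sg r s * sg s r)).
  rewrite /t /comm opprD !(sgDl D) !(sgDr D) !sgNl !sgNr.
  by split; field; rewrite !(sg_neq0 D).
have := diag_rel b_cocycle (m := r) (n := s) (l := t) (subrr _).
have ert0 : e + r + (- e + s) + t = 0.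
  by rewrite /t addrACA subrr add0r subrr.
have := diag_rel b_cocycle ert0.
rewrite (ratioK Rer) (ratioK Res) (ratioK Rr) (ratioK Rs).
rewrite !ratioD_rad ?radN // !sg_diag_rad ?radN //.
rewrite /strc (negPf Rer) (negPf Res) (negPf Rr) (negPf Rs) (negPf Rt).
rewrite !(comm_addl_rad, comm_addr_rad) ?radN // !pairD pairN => rel' rel.
have : (p e * (sg r (- r) * comm s t)) *: ratio r
    = (p e * (sg s (- s) * comm t r)) *: ratio s.
  apply/eqP; rewrite -subr_eq0 -[X in _ == X]subr0 -{1}rel' -{}rel !scalerA.
  rewrite [X in _ == X - _]addrC [X in _ == _ - X]addrC opprD addrACA subrr.
  rewrite add0r opprD addrACA -!scalerBl -scaleNr; apply/eqP.
  by congr (_ *: _ + _ *: _); ring.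

rewrite -!(scalerA (p e)) => /(scalerI pe_neq0) eq_rs.
have c_neq0 : sg r (- r) * sg s (- s) * comm r s != 0.
  by rewrite !mulf_neq0 ?(sg_neq0 D).
have [Es Er] := commE; apply: (scalerI c_neq0).
transitivity ((sg r s * sg s r) *: ((sg r (- r) * comm s t) *: ratio r)).
  by rewrite scalerA; congr (_ *: _); rewrite -mulrA Es; ring.
by rewrite eq_rs scalerA; congr (_ *: _); rewrite [RHS]mulrAC Er; ring.
Qed.

Lemma comm_non_rad r : ~~ rad r -> exists u, comm r u != 0.
Proof.
move=> /asboolPn/existsNP[u /eqP ru]; exists u.
by rewrite subr_eq0.
Qed.

(** If u does not commute with r, nor v with s, then u, v or u + v commutes
    with neither. *)
Lemma comm_connected r s : ~~ rad r -> ~~ rad s ->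
  exists t, comm r t != 0 /\ comm s t != 0.
Proof.
move=> /comm_non_rad[u ru] /comm_non_rad[v sv].
have [su|su] := eqVneq (comm s u) 0; last by exists u.
have [rv|rv] := eqVneq (comm r v) 0; last by exists v.
have commD a u' v' : comm a v' = 0 -> comm a (u' + v') = sg a v' * comm a u'.
  by rewrite /comm (sgDl D) (sgDr D) => /eqP; rewrite subr_eq0 => /eqP <-; ring.
exists (u + v); split; first by rewrite commD // mulf_neq0 ?(sg_neq0 D).
by rewrite addrC commD // mulf_neq0 ?(sg_neq0 D).
Qed.

Lemma ratio_const r s : ~~ rad r -> ~~ rad s -> ratio r = ratio s.
Proof.
move=> Rr Rs; have [t [rt st]] := comm_connected Rr Rs.
by rewrite (ratio_eq_comm rt) (ratio_eq_comm st).
Qed.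



End Classification.

Lemma virasoro_diag_double : virasoro_diag (e + e) = 2%:R^-1.
Proof. by rewrite /virasoro_diag radD // rad_e pairD; field. Qed.

(** Subtracting the Virasoro cocycle with coefficient 2 b(2e) leaves a
    diagonal cocycle that vanishes at both e and 2e, hence on the radical. *)
Theorem diag_cocycle_classification (V : lmodType K) (b : M -> V) (f : M) :
    diag_cocycle b -> b e = 0 -> ~~ rad f ->
  forall m, b m = virasoro_diag m *: (2%:R *: b (e + e))
                  + trace_diag m *: (p e *: ratio b f).
Proof.
move=> b_cocycle be0 Rf m.
have [Rm|Rm] := boolP (rad m).
  rewrite /trace_diag Rm scale0r addr0.
  have c_cocycle :=
    diag_cocycleB (2%:R *: b (e + e)) b_cocycle virasoro_diag_cocycle.
  apply/eqP; rewrite -subr_eq0; apply/eqP.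
  apply: (diag_rad_eq0 c_cocycle) => //.
    rewrite be0 /virasoro_diag rad_e divff // expr1n subrr mul0r.
    by rewrite scale0r subrr.
  by rewrite virasoro_diag_double scalerA mulVf ?pnatr_eq0 // scale1r subrr.
rewrite /virasoro_diag /trace_diag (negPf Rm) scale0r add0r ratioK //.
rewrite (ratio_const b_cocycle Rm Rf) [RHS]scalerA; congr (_ *: _).
by rewrite -mulrA divfK.
Qed.
(** * The extension by the two diagonal cocycles *)

Definition extspace : lmodType K := ({malg K[M]} * K^o * K^o)%type.

Definition eproj (u : extspace) : {malg K[M]} := u.1.1.

Definition gcoef m n : {malg K[M]} := strc m n *: << m + n >>.

Definition ecoef m n : extspace :=
  (gcoef m n, if m + n == 0 then virasoro_diag m else 0,
   if m + n == 0 then trace_diag m else 0).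

Definition gbracket := bilift gcoef.

Definition ebracket u v := bilift ecoef (eproj u) (eproj v).

Lemma eproj_linear : linear eproj. Proof. by []. Qed.

Lemma two_neq0 : 2%:R != 0 :> K. Proof. by rewrite pnatr_eq0. Qed.

Lemma diag_cocycle_jacobi (b : M -> K^o) m n l : diag_cocycle b ->
  let B x y : K^o := if x + y == 0 then b x else 0 in
  strc n l *: B m (n + l) + strc l m *: B n (l + m)
    + strc m n *: B l (m + n) = 0.
Proof.
move=> [_ b_rel] /=.
rewrite [n + (l + m)]addrC [l + (m + n)]addrC.
rewrite -[l + m + n]addrA [l + (m + n)]addrC.
rewrite [m + (n + l)]addrA.
case: eqP => [mnl0|_]; first exact: b_rel.
by rewrite !scaler0 !addr0.
Qed.

Lemma gbracket_lie : lie_bracket gbracket.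
Proof.
apply: (@lie_bracket_bilift _ _ _ idfun) => //= [|m n|m n l].
- exact: two_neq0.
- by rewrite /gcoef strc_skew addrC scaleNr.
rewrite !(linZ (bilift_linearr _ _)) !biliftU /gcoef !scalerA.
rewrite [n + (l + m)]addrC [l + (m + n)]addrC.
rewrite -[l + m + n]addrA [l + (m + n)]addrC.
rewrite [m + (n + l)]addrA -!scalerDl.
by rewrite -/(jacobiator m n l) strc_jacobi scale0r.
Qed.

Lemma ebracket_lie : lie_bracket ebracket.
Proof.
apply: lie_bracket_bilift => [||m n|m n l].
- exact: two_neq0.
- exact: eproj_linear.
- rewrite /ecoef /gcoef [n + m]addrC strc_skew scaleNr.
  case: eqP => [mn0|_]; last by congr (_, _, _); rewrite ?oppr0.
  have -> : n = - m by apply/esym/addr0_eq.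
  congr (_, _, _); apply/esym/eqP; rewrite eqr_oppLR /=; apply/eqP.
  - exact: (diag_odd virasoro_diag_cocycle).
  - exact: (diag_odd trace_diag_cocycle).
rewrite !(linZ (bilift_linearr _ _)) !biliftU.
have J := lie_jacobi gbracket_lie << m >> << n >> << l >>.
rewrite /gbracket !biliftU !(linZ (bilift_linearr _ _)) !biliftU in J.
congr (_, _, _); first exact: J.
- exact: (diag_cocycle_jacobi m n l virasoro_diag_cocycle).
- exact: (diag_cocycle_jacobi m n l trace_diag_cocycle).
Qed.

Lemma gbracketU m n : gbracket << m >> << n >> = strc m n *: << m + n >>.
Proof. exact: biliftU. Qed.

Lemma eproj_bracket u v : eproj (ebracket u v) = gbracket (eproj u) (eproj v).
Proof.
rewrite /ebracket; move: (eproj u) (eproj v) => {u v}.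
apply: (@malg_bilinear_ext _ _ _ (fun x y => eproj (bilift ecoef x y)) gbracket)
  => [y a x x'|x a y y'|y|x|m n].
- by rewrite bilift_linearl.
- by rewrite bilift_linearr.
- exact: bilift_linearl.
- exact: bilift_linearr.
- by rewrite gbracketU biliftU.
Qed.

Lemma ebracket_central : central_extension gbracket ebracket eproj.
Proof.
split; [exact: gbracket_lie | exact: ebracket_lie | | |].
- by split; [exact: eproj_linear | exact: eproj_bracket].
- by move=> x; exists (x, 0, 0).
- by move=> u u0 v; rewrite /ebracket u0 (lin0 (bilift_linearl _ _)).
Qed.
(** * Lifting the algebra to a central extension *)

Lemma lie_skew (V : lmodType K) (br : V -> V -> V) (x y : V) :
  lie_bracket br -> br x y = - br y x.
Proof.
move=> lie; apply/eqP; rewrite -addr_eq0.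
have := lie_alt lie (x + y).
rewrite (linD (lie_linearl lie _)) !(linD (lie_linearr lie _)).
by rewrite !(lie_alt lie) add0r addr0 => ->.
Qed.

Section CentralLift.
Variables (F : lmodType K) (brF : F -> F -> F) (q : F -> {malg K[M]}).
Hypothesis extF : central_extension gbracket brF q.

Let lieF := cext_total extF.

Lemma bracket_lift_indep u u' v v' :
  q u = q u' -> q v = q v' -> brF u v = brF u' v'.
Proof.
have q_lin := (cext_hom extF).1.
have left_indep x x' y : q x = q x' -> brF x y = brF x' y.
  move=> qxx'; apply/eqP.
  rewrite -subr_eq0 -(linB (lie_linearl lieF y)); apply/eqP.
  by apply: (cext_central extF); rewrite (linB q_lin) qxx' subrr.
move=> qu qv; rewrite (left_indep _ _ _ qu) (lie_skew _ _ lieF).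
by rewrite (left_indep _ _ _ qv) -(lie_skew _ _ lieF).
Qed.

(** For m <> 0 the bracket of any lifts of L_0 and L_m is already an
    eigenvector, because it depends only on L_0 and L_m. The choice of X_0
    normalises the defect to vanish at e. *)
Lemma weight_lift : exists X : M -> F,
  [/\ forall m, q (X m) = << m >>,
      forall m, brF (X 0) (X m) = p m *: X m
    & brF (X e) (X (- e)) = strc e (- e) *: X 0].
Proof.
have [q_lin q_br] := cext_hom extF.
have [l ql] := choice (fun m : M => cext_surj extF << m >>).
pose Y m := (p m)^-1 *: brF (l 0) (l m).
have qY m : m != 0 -> q (Y m) = << m >>.
  move=> m0; rewrite (linZ q_lin) q_br !ql gbracketU strc0 add0r scalerA.
  by rewrite mulVf ?scale1r ?pair_neq0.
have se_neq0 : strc e (- e) != 0.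
  by rewrite strc_opp rad_e oppr_eq0 mulf_neq0 ?two_neq0.
pose X m := if m == 0 then (strc e (- e))^-1 *: brF (Y e) (Y (- e)) else Y m.
have ne0 : - e != 0 by rewrite oppr_eq0.
have qX m : q (X m) = << m >>.
  rewrite /X; case: eqP => [->|/eqP]; last exact: qY.
  rewrite (linZ q_lin) q_br !qY // gbracketU subrr scalerA.
  by rewrite mulVf ?scale1r.
exists X; split=> // [m|]; last first.
  by rewrite {3}/X eqxx scalerA divff // scale1r /X (negPf e_neq0) (negPf ne0).
have [-> | m0] := eqVneq m 0; first by rewrite (lie_alt lieF) pair0 scale0r.
rewrite (bracket_lift_indep (u' := l 0) (v' := l m)) ?qX ?ql //.
by rewrite {1}/X (negPf m0) scalerA divff ?scale1r ?pair_neq0.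
Qed.

Variable X : M -> F.
Hypotheses (qX : forall m, q (X m) = << m >>)
  (X_weight : forall m, brF (X 0) (X m) = p m *: X m)
  (X_norm : brF (X e) (X (- e)) = strc e (- e) *: X 0).

Definition defect m := brF (X m) (X (- m)) - strc m (- m) *: X 0.

Lemma defect_ker m : q (defect m) = 0.
Proof.
have [q_lin q_br] := cext_hom extF.
by rewrite (linB q_lin) (linZ q_lin) q_br !qX gbracketU !subrr.
Qed.

(** If m + n <> 0, both sides are eigenvectors of X_0 for the nonzero
    eigenvalue p(m + n), and equal modulo the centre; bracketing with X_0
    makes them equal. *)
Lemma weight_bracket m n :
  brF (X m) (X n)
    = strc m n *: X (m + n) + (if m + n == 0 then defect m else 0).
Proof.
case: eqP => [mn0 | /eqP mn0].
  have -> : n = - m by apply/esym/addr0_eq.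
  by rewrite subrr addrC subrK.
have [q_lin q_br] := cext_hom extF.
rewrite addr0; apply: (scalerI (pair_neq0 mn0)).
transitivity (brF (X 0) (brF (X m) (X n))).
  have := lie_jacobi lieF (X 0) (X m) (X n).
  rewrite X_weight (linZ (lie_linearr lieF _)).
  rewrite [brF (X n) (X 0)](lie_skew _ _ lieF) X_weight -scaleNr.
  rewrite (linZ (lie_linearr lieF _)) [brF (X n) (X m)](lie_skew _ _ lieF).
  rewrite scalerN -addrA => /eqP; rewrite addr_eq0 => /eqP ->.
  by rewrite pairD scalerDl scaleNr -opprD opprK addrC.
rewrite (bracket_lift_indep (u' := X 0) (v' := strc m n *: X (m + n))) //.
  by rewrite (linZ (lie_linearr lieF _)) X_weight !scalerA mulrC.
by rewrite q_br (linZ q_lin) !qX gbracketU.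
Qed.

(** This is the Jacobi identity on X_m, X_n and X_l, whose component along
    X_0 vanishes by the Jacobi identity of the structure constants. *)
Lemma defect_cocycle : diag_cocycle defect.
Proof.
have [q_lin q_br] := cext_hom extF.
split=> [m|m n l mnl0].
  rewrite /defect opprK (lie_skew _ _ lieF) [strc (- m) m]strc_skew.
  by rewrite scaleNr opprB opprK addrC.
have term a b c : a + b + c = 0 ->
    brF (X a) (brF (X b) (X c)) = strc b c *: defect a
      + (strc b c * strc a (b + c)) *: X 0.
  move=> abc0.
  rewrite (@bracket_lift_indep _ (X a) _ (strc b c *: X (b + c))) //.
    rewrite (linZ (lie_linearr lieF _)) weight_bracket addrA abc0 eqxx scalerDr.
    by rewrite addrC scalerA.
  by rewrite q_br (linZ q_lin) !qX gbracketU.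
have nlm0 : n + l + m = 0 by rewrite addrC addrA.
have lmn0 : l + m + n = 0 by rewrite -addrA addrC.
have := lie_jacobi lieF (X m) (X n) (X l); rewrite !term //.
rewrite (addrACA (strc n l *: _)) (addrACA (strc n l *: _ + _)) -!scalerDl.
by rewrite -/(jacobiator m n l) strc_jacobi scale0r addr0.
Qed.

Lemma defect_e : defect e = 0.
Proof. by rewrite /defect X_norm subrr. Qed.

Definition lift_hom a1 a2 (u : extspace) : F :=
  mlift X u.1.1 + u.1.2 *: a1 + u.2 *: a2.

Lemma lift_hom_linear a1 a2 : linear (lift_hom a1 a2).
Proof.
move=> a [[x s] t] [[x' s'] t']; rewrite /lift_hom /= mlift_linear.
rewrite !scalerDr !scalerDl !scalerA.
by rewrite [RHS]addrACA; congr (_ + _); rewrite addrACA.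
Qed.

Lemma lift_hom_lie a1 a2 : q a1 = 0 -> q a2 = 0 ->
    (forall m, defect m = virasoro_diag m *: a1 + trace_diag m *: a2) ->
  lie_hom ebracket brF (lift_hom a1 a2) /\
    forall u, q (lift_hom a1 a2 u) = eproj u.
Proof.
move=> qa1 qa2 defectE; have [q_lin q_br] := cext_hom extF.
have qmlift x : q (mlift X x) = x.
  apply: (@malg_linear_ext _ _ _ (fun x => q (mlift X x)) idfun)
    => // [a y z|m].
    by rewrite mlift_linear q_lin.
  by rewrite mliftU qX.
have qlift u : q (lift_hom a1 a2 u) = eproj u.
  rewrite /lift_hom !(linD q_lin) !(linZ q_lin) qa1 qa2 !scaler0 !addr0.
  exact: qmlift.
split=> //; split; first exact: lift_hom_linear.
move=> u v.
rewrite (@bracket_lift_indep _ (mlift X (eproj u)) _ (mlift X (eproj v)))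
  ?qlift ?qmlift //.
rewrite /ebracket; move: (eproj u) (eproj v) => {u v}.
apply: (@malg_bilinear_ext _ _ _
    (fun x y => lift_hom a1 a2 (bilift ecoef x y))
    (fun x y => brF (mlift X x) (mlift X y)))
  => [y a x x'|x a y y'|y a x x'|x a y y'|m n].
- by rewrite bilift_linearl lift_hom_linear.
- by rewrite bilift_linearr lift_hom_linear.
- by rewrite mlift_linear (lie_linearl lieF).
- by rewrite mlift_linear (lie_linearr lieF).
rewrite biliftU !mliftU weight_bracket /lift_hom /= (linZ (mlift_linear X)).
rewrite mliftU -addrA; congr (_ + _).
by case: eqP => _; rewrite ?scale0r ?addr0 // defectE.
Qed.

End CentralLift.

(** * Centre and universality *)

Lemma mcoeff_gbracket x m n :
  (gbracket x << n >>)@_(m + n) = x@_m * strc m n.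
Proof.
apply: (@malg_linear_ext _ _ K^o (fun x => (gbracket x << n >>)@_(m + n))
  (fun x => x@_m * strc m n)) => [a u v|a u v|l].
- by rewrite /gbracket bilift_linearl mcoeffD mcoeffZ.
- by rewrite mcoeffD mcoeffZ mulrDl -mulrA.
rewrite gbracketU mcoeffZ !mcoeffU (inj_eq (addIr n)).
by case: eqP => [->|_]; rewrite ?mulr1 ?mul1r ?mulr0 ?mul0r.
Qed.

(** A central element has its base component killed by L_0, hence supported
    in degree 0, and then killed by L_e, hence zero. *)
Lemma ebracket_center u : lie_center ebracket u <-> eproj u = 0.
Proof.
split=> [uC|]; last exact: (cext_central ebracket_central).
have x_strc m n : (eproj u)@_m * strc m n = 0.
  have := eproj_bracket u (<< n >>, 0, 0).
  rewrite uC => /esym/(congr1 (mcoeff (m + n))).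
  by rewrite mcoeff_gbracket mcoeff0.
apply/malgP => m; rewrite mcoeff0; apply/eqP.
have [-> | m0] := eqVneq m 0.
  have /eqP := x_strc 0 e.
  by rewrite strc0 mulf_eq0 (negPf pe_neq0) orbF.
have /eqP := x_strc m 0.
by rewrite strc_skew strc0 mulf_eq0 oppr_eq0 (negPf (pair_neq0 m0)) orbF.
Qed.

Variable f : M.
Hypothesis non_rad_f : ~~ rad f.

Lemma virasoro_diag_e : virasoro_diag e = 0.
Proof. by rewrite /virasoro_diag rad_e divff // expr1n subrr mul0r. Qed.

Lemma trace_diag_neq0 : trace_diag f != 0.
Proof.
rewrite /trace_diag (negPf non_rad_f) !mulf_neq0 ?invr_neq0 ?(sg_neq0 D) //.
by rewrite pair_neq0 // non_rad_neq0.
Qed.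

(** Perfectness: [L_0, L_m] gives L_m for m <> 0, [L_e, L_(-e)] gives L_0
    because the Virasoro cocycle vanishes at e; the opposite pairs of
    degrees 2e and f then give the two central vectors. *)
Lemma ebracket_span (V : lmodType K) (h : extspace -> V) :
  linear h -> (forall u v, h (ebracket u v) = 0) -> forall u, h u = 0.
Proof.
move=> h_lin h_br.
have h_coef m n : h (ecoef m n) = 0.
  by rewrite -(h_br (<< m >>, 0, 0) (<< n >>, 0, 0)) /ebracket biliftU.
pose L m : extspace := (<< m >>, 0, 0).
pose C1 : extspace := (0, 1, 0).
pose C2 : extspace := (0, 0, 1).
have ecoefE m n : ecoef m n = strc m n *: L (m + n)
    + (if m + n == 0 then virasoro_diag m : K else 0) *: C1
    + (if m + n == 0 then trace_diag m : K else 0) *: C2.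
  congr (_, _, _); rewrite /= ?scaler0 ?add0r ?addr0 //.
  - by rewrite /GRing.scale /= mulr1.
  - by rewrite /GRing.scale /= mulr1.
have hE m n : strc m n *: h (L (m + n))
    + (if m + n == 0 then virasoro_diag m : K else 0) *: h C1
    + (if m + n == 0 then trace_diag m : K else 0) *: h C2 = 0.
  by rewrite -!(linZ h_lin) -!(linD h_lin) -ecoefE h_coef.
have scale_eq0 (c : K) (v : V) : c != 0 -> c *: v = 0 -> v = 0.
  by move=> c0 /eqP; rewrite scaler_eq0 (negPf c0) => /eqP.
have strc_e_neq0 x : rad x -> x != 0 -> strc x (- x) != 0.
  move=> Rx x0; rewrite strc_opp Rx oppr_eq0 mulf_neq0 ?two_neq0 //.
  exact: pair_neq0.
have trace_diag_rad x : rad x -> trace_diag x = 0 by rewrite /trace_diag => ->.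
have hL0 : h (L 0) = 0.
  have := hE e (- e); rewrite subrr eqxx virasoro_diag_e trace_diag_rad //.
  rewrite !scale0r !addr0.
  by apply: scale_eq0; apply: strc_e_neq0.
have hL m : h (L m) = 0.
  have [->|m0] // := eqVneq m 0.
  have := hE 0 m; rewrite add0r (negPf m0) !scale0r !addr0 strc0.
  by apply: scale_eq0; apply: pair_neq0.
have hC1 : h C1 = 0.
  have := hE (e + e) (- (e + e)).
  rewrite subrr eqxx hL scaler0 add0r trace_diag_rad ?radD // scale0r addr0.
  rewrite virasoro_diag_double.
  by apply: scale_eq0; rewrite invr_neq0 ?two_neq0.
have hC2 : h C2 = 0.
  have := hE f (- f); rewrite hL hC1 !scaler0 !add0r subrr eqxx.
  by apply: scale_eq0; exact: trace_diag_neq0.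
case=> [[x s] t].
have -> : ((x, s, t) : extspace) = (x, 0, 0) + (s : K) *: C1 + (t : K) *: C2.
  congr (_, _, _); rewrite /= ?scaler0 ?add0r ?addr0 //.
  - by rewrite /GRing.scale /= mulr1.
  - by rewrite /GRing.scale /= mulr1.
rewrite !(linD h_lin) !(linZ h_lin) hC1 hC2 !scaler0 !addr0.
apply: (@malg_linear_ext _ _ _ (fun x => h (x, 0, 0)) (fun=> 0))
  => [a y z|a y z|m]; last exact: hL.
- rewrite -h_lin; congr (h (_, _, _)).
  + by rewrite /= scaler0 addr0.
  + by rewrite /= scaler0 addr0.
- by rewrite scaler0 addr0.
Qed.

Theorem ebracket_universal :
  universal_central_extension gbracket ebracket eproj.
Proof.
split=> [|F brF q extF]; first exact: ebracket_central.
have [X [qX X_weight X_norm]] := weight_lift extF.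
have q_lin := (cext_hom extF).1.
have b_cocycle := defect_cocycle extF qX X_weight.
have be0 := defect_e X_norm.
have bE := diag_cocycle_classification b_cocycle be0 non_rad_f.
set a1 := 2%:R *: _ in bE; set a2 := p e *: _ in bE.
have qa1 : q a1 = 0 by rewrite (linZ q_lin) (defect_ker extF qX) scaler0.
have qa2 : q a2 = 0.
  by rewrite !(linZ q_lin) (defect_ker extF qX) !scaler0.
have [g_hom qg] := lift_hom_lie extF qX X_weight qa1 qa2 bE.
exists (lift_hom X a1 a2); split=> // g' [g'_hom qg'].
apply/funext => u; apply/eqP; rewrite -subr_eq0; apply/eqP; move: u.
apply: ebracket_span => [a u v|u v].
  rewrite g_hom.1 g'_hom.1 scalerBr opprD.
  by rewrite addrACA.
rewrite g_hom.2 g'_hom.2; apply/eqP; rewrite subr_eq0; apply/eqP.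
by apply: (bracket_lift_indep extF); rewrite qg qg'.
Qed.

End ReferencePoint.

End Structure.

(** * The lattice and the normal form of Q *)

Section NormalForm.
Variables (C : numFieldType) (d : nat).
Implicit Types (gam : 'rV[C]_d) (m n : lattice d).

Lemma pairingB gam : {morph pairing gam : m n / m - n}.
Proof.
move=> m n; rewrite /pairing -sumrB; apply: eq_bigr => i _.
by rewrite !mxE rmorphB mulrBr.
Qed.

Lemma pairing_eq0 gam m : generic gam -> pairing gam m = 0 -> m = 0.
Proof.
move=> hgam m0; have a0 : map_mx intr m = 0 :> 'rV[rat]_d.
  apply: hgam; rewrite -[RHS]m0; apply: eq_bigr => i _.
  by rewrite mxE ratr_int mulrC.
apply/rowP => i; have /rowP/(_ i)/eqP := a0.
by rewrite !mxE intr_eq0 => /eqP.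
Qed.

Variables (Q : 'M[C]_d) (z : nat) (q : 'I_d -> C) (k : 'I_d -> nat).
Hypothesis hQ : normal_form Q z q k.

Lemma coupled_lt (a b : 'I_d) : coupled z a b -> (a < 2 * z)%N.
Proof. by case/and3P => _ /eqP -> /ltnW. Qed.

Lemma root_neq0 (a : 'I_d) : (a < 2 * z)%N -> q a != 0.
Proof.
move=> /(nf_order hQ)[k1 /prim_expr_order qk]; apply/eqP => q0.
move: qk; rewrite q0 expr0n gtn_eqF ?(ltnW k1) // => /eqP.
by rewrite eq_sym oner_eq0.
Qed.

Lemma entry_neq0 a b : Q a b != 0.
Proof.
rewrite (nf_entry hQ); case: ifP; last by rewrite oner_eq0.
case/orP => [/coupled_lt | /and3P[_ _]]; exact: root_neq0.
Qed.

Lemma entry_lt (i j : 'I_d) : (i < j)%N ->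
  Q j i = if coupled z i j then q j else 1.
Proof.
move=> ij; rewrite (nf_entry hQ) [coupled z j i](_ : _ = false) //.
by apply/and3P => -[_ /eqP ji _]; move: ij; rewrite ji ltnNge leqnSn.
Qed.

Lemma sigmaDl m n l : sigma Q (m + n) l = sigma Q m l * sigma Q n l.
Proof.
rewrite /sigma -big_split; apply: eq_bigr => i _; rewrite -big_split.
by apply: eq_bigr => j _; rewrite mxE mulrDl expfzDr ?entry_neq0.
Qed.

Lemma sigmaDr m n l : sigma Q l (m + n) = sigma Q l m * sigma Q l n.
Proof.
rewrite /sigma -big_split; apply: eq_bigr => i _; rewrite -big_split.
by apply: eq_bigr => j _; rewrite mxE mulrDr expfzDr ?entry_neq0.
Qed.

Lemma sigma_neq0 m n : sigma Q m n != 0.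
Proof.
by do 2![apply/prodf_neq0 => ? _]; rewrite expfz_neq0 ?entry_neq0.
Qed.

Lemma sigma_eps_r m (i : 'I_d) :
  sigma Q m (eps i) = \prod_(j < d | (i < j)%N) Q j i ^ m 0 j.
Proof.
rewrite /sigma (bigD1 i) //= [X in _ * X]big1 ?mulr1 => [|a ai].
  by apply: eq_bigr => j _; rewrite mxE !eqxx mulr1.
by apply: big1 => j _; rewrite mxE eqxx (negPf ai) mulr0 expr0z.
Qed.

(** A coupled pair starts at an even index, and only its second member
    occurs in the left argument of sigma. *)
Lemma sigma_eps_even (i : 'I_d) n : ~~ odd i -> sigma Q (eps i) n = 1.
Proof.
move=> i_even; rewrite /sigma big1 // => a _; rewrite big1 // => j aj.
rewrite mxE eqxx /=; have [ji|ji] := eqVneq j i; last by rewrite mul0r expr0z.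
rewrite entry_lt // -ji in i_even *; case: ifP => [/and3P[a_even /eqP ja _]|_].
  by move: i_even; rewrite ja /= negbK (negPf a_even).
by rewrite exp1rz.
Qed.

(** For a coupled pair (i, j), commuting with epsilon_i already forces this,
    since sigma(epsilon_i, m) = 1 while sigma(m, epsilon_i) is the power in
    question. *)
Lemma entry_radical m (i j : 'I_d) :
  sradical Q m -> (i < j)%N -> Q j i ^ m 0 j = 1.
Proof.
move=> Rm ij; rewrite entry_lt //; case: ifP => [cij|_]; last by rewrite exp1rz.
have [i_even /eqP ji _] := and3P cij.
have := Rm (eps i); rewrite (sigma_eps_even _ i_even) sigma_eps_r.
rewrite (bigD1 j) //= big1 ?mulr1 => [|a /andP[ia aj]].
  by rewrite entry_lt // cij.
rewrite entry_lt // ifF ?exp1rz //; apply/and3P => -[_ /eqP ai _].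
by case/eqP: aj; apply: val_inj; rewrite /= ai ji.
Qed.

Lemma sigma_radical m n : sradical Q m -> sigma Q m n = 1.
Proof.
move=> Rm; rewrite /sigma big1 // => i _; rewrite big1 // => j ij.
by rewrite -exprz_exp (entry_radical Rm ij) exp1rz.
Qed.

Lemma normal_form_torus_datum gam :
  generic gam -> torus_datum (pairing gam) (sigma Q).
Proof.
move=> hgam; split.
- exact: pairingB.
- by move=> m; exact: pairing_eq0.
- exact: sigmaDl.
- exact: sigmaDr.
- exact: sigma_neq0.
- by move=> m n /asboolP Rm; exact: sigma_radical.
Qed.

Hypothesis hd : (1 < d)%N.

Let i1 : 'I_d := Ordinal (ltnW hd).

Lemma order_gt1 : (1 < k i1)%N.
Proof.
by case: (nf_order hQ (a := i1)); rewrite //= muln_gt0 (nf_z_gt0 hQ).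
Qed.

Lemma radical_period : sradical Q (eps i1 *+ k i1).
Proof.
move=> n.
have -> : sigma Q (eps i1 *+ k i1) n = sigma Q (eps i1) n ^+ k i1.
  elim: (k i1) => [|c IH].
    rewrite mulr0n expr0 /sigma big1 // => i _; rewrite big1 // => j _.
    by rewrite mxE mul0r expr0z.
  by rewrite mulrS exprS sigmaDl IH.
rewrite sigma_eps_even // expr1n; apply/esym.
rewrite /sigma big1 // => i _; rewrite big1 // => j ij.
rewrite mulmxnE !mxE eqxx /=; have [ii1|_] := eqVneq i i1; last first.
  by rewrite mul0rn mulr0 expr0z.
rewrite mulrC -exprz_exp mulr1n natz -exprnP entry_lt //.
case: ifP => [cij|_]; last first.
  by rewrite expr1n exp1rz.
have [_ q_root] := nf_order hQ (coupled_lt cij).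
by rewrite (nf_inv hQ cij) exprVn -ii1 (prim_expr_order q_root) invr1 exp1rz.
Qed.

(** The degree epsilon_2, coupled with epsilon_1, is a witness: the two do
    not commute, as q_1 is not 1. *)
Lemma eps_not_radical : ~ sradical Q (eps i1).
Proof.
pose j1 : 'I_d := Ordinal hd.
have c11 : coupled z i1 j1.
  by rewrite /coupled /= -[2%N]muln1 leq_pmul2l // (nf_z_gt0 hQ).
move=> /(_ (eps j1)); rewrite sigma_eps_even // sigma_eps_r.
rewrite (bigD1 j1) //= big1 ?mulr1 => [|a /andP[_ aj]]; last first.
  by rewrite mxE eqxx (negPf aj) expr0z.
rewrite mxE !eqxx /= expr1z entry_lt // c11 (nf_inv hQ c11) => /esym/eqP.
have [_ q_root] := nf_order hQ (coupled_lt c11).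
rewrite invr_eq1 => /eqP q1; have := prim_order_dvd q_root 1.
rewrite expr1 q1 eqxx dvdn1 => /eqP k1; have := order_gt1.
by rewrite k1.
Qed.

Lemma period_neq0 : eps i1 *+ k i1 != 0.
Proof.
apply/eqP => /matrixP/(_ 0 i1)/eqP.
rewrite mulmxnE !mxE !eqxx /= pnatr_eq0; apply/negP.
by rewrite -lt0n (ltnW order_gt1).
Qed.

End NormalForm.

Lemma gbrE (C : numFieldType) (d : nat) (gam : 'rV[C]_d) (Q : 'M[C]_d) :
  gbr gam Q = gbracket (pairing gam) (sigma Q).
Proof.
apply/funext => x; apply/funext => y.
apply: eq_bigr => m _; rewrite /mlift scaler_sumr; apply: eq_bigr => n _.
by rewrite !scalerA.
Qed.

(** * The theorem *)

Theorem theorem4p7 (R : realType) (d : nat) (hd : (1 < d)%N)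
    (gam : 'rV[R[i]]_d) (Q : 'M[R[i]]_d)
    (z : nat) (q : 'I_d -> R[i]) (k : 'I_d -> nat)
    (hgam : generic gam) (hQ : normal_form Q z q k) :
  let i1 : 'I_d := Ordinal (ltnW hd) in
  let e1 : lattice d := eps i1 in
  let k1 : nat := k i1 in
  let L : lattice d -> gtspace R[i] d := fun m => gincl (Lb R[i] m) in
  let c1 : gtspace R[i] d := c1 R[i] d in
  let c2 : gtspace R[i] d := c2 R[i] d in
  let nrm : lattice d -> R[i] :=
    fun m => pairing gam m / pairing gam (e1 *+ k1) in
  exists br' : gtspace R[i] d -> gtspace R[i] d -> gtspace R[i] d,
    let alpha : gspace R[i] d -> gspace R[i] d -> gtspace R[i] d :=
      fun x y => br' (gincl x) (gincl y) - gincl (gbr gam Q x y) in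
    universal_central_extension (gbr gam Q) br' (@gproj R[i] d) /\
    (forall x : gtspace R[i] d,
       lie_center br' x <->
       exists! ab : R[i] * R[i], x = ab.1 *: c1 + ab.2 *: c2) /\
    (forall m n : lattice d, sradical Q m -> sradical Q n ->
       br' (L m) (L n) =
         pairing gam (n - m) *: L (m + n)
         + (if m + n == 0 then (nrm m ^+ 3 - nrm m) / 12%:R else 0) *: c1) /\
    (forall m s : lattice d, sradical Q m -> ~ sradical Q s ->
       br' (L m) (L s) = pairing gam s *: L (m + s)) /\
    (forall r s : lattice d, ~ sradical Q r -> ~ sradical Q s ->
       br' (L r) (L s) =
         (sigma Q r s - sigma Q s r) *: L (r + s)
         + (if r + s == 0 then sigma Q r (- r) * nrm r else 0) *: c2) /\
    (forall x : gtspace R[i] d, br' c1 x = 0 /\ br' c2 x = 0) /\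
    c1 = 2%:R *: alpha (Lb R[i] (e1 *+ (2 * k1))) (Lb R[i] (- (e1 *+ (2 * k1)))) /\
    c2 = k1%:R *: alpha (Lb R[i] e1) (Lb R[i] (- e1)).
Proof.
move=> i1 e1 k1 L c1 c2 nrm.
pose p := pairing gam; pose sg := sigma Q; pose e := e1 *+ k1.
have D : torus_datum p sg := normal_form_torus_datum hQ hgam.
have Re : rad sg e by apply/asboolP; exact: (radical_period hQ).
have e0 : e != 0 by exact: (period_neq0 hQ).
have Rf : ~~ rad sg e1 by apply/asboolPn; exact: (eps_not_radical hQ).
pose br' : gtspace R[i] d -> gtspace R[i] d -> gtspace R[i] d :=
  ebracket p sg e.
have brL m n : br' (L m) (L n) = ecoef p sg e m n by exact: biliftU.
have alphaL m n : br' (L m) (L n) - gincl (gbr gam Q (Lb _ m) (Lb _ n))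
    = (0, if m + n == 0 then virasoro_diag p sg e m else 0,
       if m + n == 0 then trace_diag p sg e m else 0).
  rewrite brL gbrE gbracketU.
  by congr (_, _, _); rewrite /= ?subrr ?subr0.
have combE (a b : R[i]) : a *: c1 + b *: c2 = (0, a, b).
  congr (_, _, _); rewrite /= ?scaler0 ?addr0 ?add0r //.
    by rewrite /GRing.scale /= mulr1.
  by rewrite /GRing.scale /= mulr1.
exists br' => /=.
split; [|split; [|split; [|split; [|split; [|split; [|split]]]]]].
- by rewrite gbrE; exact: (ebracket_universal D Re e0 Rf).
- move=> x; split.
    move/(ebracket_center D e0 _) => x0; case: x x0 => [[x s] t] /= x0.
    exists (s, t); split=> [|[a b]] /=; first by rewrite combE -x0.
    by rewrite combE => -[_ -> ->].
  move=> [[a b] [-> _]]; apply/(ebracket_center D e0 _).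
  by rewrite combE.
- move=> m n /asboolP Rm /asboolP Rn; rewrite brL -[RHS]addr0 -(scale0r c2).
  rewrite -addrA combE /ecoef /gcoef /strc /virasoro_diag /trace_diag.
  rewrite /rad Rm Rn.
  congr (_, _, _); rewrite /= ?scaler0 ?addr0 ?add0r //.
  by rewrite if_same.
- move=> m s /asboolP Rm Rs; rewrite brL.
  have /eqP ms0 : m + s != 0.
    apply: contra_notN Rs => /eqP ms0; apply/asboolP; change (rad sg s).
    by rewrite -(radD D s Rm) ms0 (rad0 D).
  rewrite /ecoef /gcoef /strc /rad Rm; case: asboolP => // _; case: eqP => // _.
  by congr (_, _, _); rewrite /= scaler0.
- move=> r s /asboolPn/negPf Rr /asboolPn/negPf Rs; rewrite brL.
  rewrite -[X in _ = _ + X]add0r -(scale0r c1).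
  rewrite combE /ecoef /gcoef /strc /virasoro_diag /trace_diag /rad Rr Rs.
  congr (_, _, _); rewrite /= ?scaler0 ?addr0 ?add0r //.
  by rewrite if_same.
- by move=> x; split; apply: (ebracket_center D e0 _).2.
- rewrite -/(L _) alphaL subrr eqxx.
  have -> : e1 *+ (2 * k1) = e + e by rewrite mulnC mulrnA mulr2n.
  rewrite (virasoro_diag_double D) // /trace_diag (radD D) // Re.
  by congr (_, _, _); rewrite /= ?scaler0 // /GRing.scale /= divff ?pnatr_eq0.
- rewrite -/(L _) alphaL subrr eqxx /virasoro_diag /trace_diag (negPf Rf).
  have -> : sg e1 (- e1) = 1 by apply: (sigma_eps_even hQ).
  congr (_, _, _); rewrite /= ?scaler0 // mul1r /GRing.scale /=.
  have -> : p e = k1%:R * p e1.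
    rewrite /e; elim: (k1) => [|c IH].
      by rewrite mulr0n mul0r (pair0 D).
    by rewrite mulrS (pairD D) IH; ring.
  have pe1 : p e1 != 0 by apply: (pair_neq0 D); apply: (non_rad_neq0 D).
  have k0 : k1%:R != 0 :> R[i].
    by rewrite pnatr_eq0 -lt0n ltnW // (order_gt1 hQ).
  by field; rewrite pe1.
Qed.
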